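(* Assume that $\lambda_{m-1}<\lambda_m$ if $m>1$, and $\lambda_M<\lambda_{M+1}$. Then $$\|A^{1/2}(\gamma^0-\gamma_h)\|_{\mathfrak S_2(\mathcal H)}^2\le\|\mathrm{Res}(\gamma_h)\|_{\mathfrak S_2(\mathcal H)}^2+(\lambda_M+\lambda_{Mh})\|\gamma^0-\gamma_h\|_{\mathfrak S_2(\mathcal H)}^2.$$ Assume in addition that $\|\gamma_hv\|\ne0$ for all $v\in\mathrm{Span}\{\varphi_m^0,\dots,\varphi_M^0\}\setminus\{0\}$, and that there is a real number $\underline\lambda_{M+1}$ and, with $\overline\lambda_{m-1}:=\lambda_{(m-1)h}$ if $m>1$, $$\lambda_{m-1}\le\overline\lambda_{m-1}<\lambda_{mh}\ \text{ when } m>1,\qquad\lambda_{Mh}<\underline\lambda_{M+1}\le\lambda_{M+1}.$$ Set $$c_h:=\max\left[\Big(\tfrac{\lambda_{mh}}{\overline\lambda_{m-1}}-1\Big)^{-1},\Big(1-\tfrac{\lambda_{Mh}}{\underline\lambda_{M+1}}\Big)^{-1}\right],$$ the first term in the $\max$ being discarded for $m=1$. Then also $$\|A^{1/2}(\gamma^0-\gamma_h)\|_{\mathfrak S_2(\mathcal H)}^2\le2c_h^2\|\mathrm{Res}(\gamma_h)\|_{\mathfrak S_2(\mathcal H)}^2+\frac{\lambda_M}2\|\gamma^0-\gamma_h\|_{\mathfrak S_2(\mathcal H)}^4.$$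
   Context: $\mathcal H$ is a real separable Hilbert space with inner product $(\cdot,\cdot)$ and norm $\|\cdot\|$; $\|B\|_{\mathfrak S_2(\mathcal H)}$ is the Hilbert–Schmidt norm. $A$ is a self-adjoint, positive definite operator on $\mathcal H$ with domain $D(A)$ and compact resolvent; $(\lambda_k)_{k\ge1}$ is the nondecreasing sequence of its (positive) eigenvalues counted with multiplicity, $\lambda_k\to+\infty$, and $(\varphi_k^0)_{k\ge1}$ is an orthonormal basis of $\mathcal H$ with $A\varphi_k^0=\lambda_k\varphi_k^0$. For $s\in\mathbb{R}$, $D(A^s):=\{v\in\mathcal H:\sum_k\lambda_k^{2s}|(v,\varphi_k^0)|^2<\infty\}$ and $A^sv:=\sum_k\lambda_k^s(v,\varphi_k^0)\varphi_k^0$. Let $1\le m\le M$ be integers. $V_h\subset D(A^{1/2})$ is a finite-dimensional subspace with $\dim V_h\ge M$. The approximate eigenpairs $(\varphi_{kh},\lambda_{kh})\in V_h\times\mathbb{R}_+$, $1\le k\le\dim V_h$, satisfy $(\varphi_{kh},\varphi_{jh})=\delta_{kj}$, $(A^{1/2}\varphi_{kh},A^{1/2}v_h)=\lambda_{kh}(\varphi_{kh},v_h)$ for all $v_h\in V_h$, and $0<\lambda_{1h}\le\lambda_{2h}\le\cdots$ (counting multiplicities). The density matrices are $\gamma^0v:=\sum_{i=m}^M(v,\varphi_i^0)\varphi_i^0$ and $\gamma_hv:=\sum_{i=m}^M(v,\varphi_{ih})\varphi_{ih}$ for $v\in\mathcal H$. The cluster residual is the bounded operator $\mathrm{Res}(\gamma_h):=A^{1/2}\gamma_h-A^{-1/2}(A^{1/2}\gamma_h)^\dagger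 A^{1/2}\gamma_h$ on $\mathcal H$, where $B^\dagger$ denotes the adjoint of a bounded operator $B$. *)

(* Defs.v *)
From HB Require Import structures.
From mathcomp Require Import all_boot all_order all_algebra.
From mathcomp Require Import sesquilinear.
From mathcomp Require Import all_classical all_reals all_analysis.

Set Implicit Arguments.
Unset Strict Implicit.
Unset Printing Implicit Defensive.

Import Order.TTheory GRing.Theory Num.Theory.
Import numFieldNormedType.Exports.

Local Open Scope classical_set_scope.
Local Open Scope ring_scope.

(* A real Hilbert space is a complete normed module [H] over [R : realType]
   together with a positive definite symmetric bilinear form [ip] (the
   library's [{dot H for idfun}]) such that [ip x x = `|x| ^+ 2].

   Sequences of vectors and eigenvalues are indexed from 1: they are functions
   on [nat] whose value at 0 is irrelevant. *)

Definition separable (T : topologicalType) : Prop :=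
  exists2 S : set T, countable S & dense S.

Section Operators.
Context {R : realType} {H : completeNormedModType R}.
Variable ip : {dot H for idfun}.

Definition induces_norm : Prop := forall x : H, ip x x = `|x| ^+ 2.

Definition orthonormal_basis (e : nat -> H) : Prop :=
  (forall j k : nat, (1 <= j)%N -> (1 <= k)%N -> ip (e j) (e k) = (j == k)%:R)
  /\ (forall v : H,
        (fun n : nat => \sum_(1 <= k < n.+1) ip v (e k) *: e k) @ \oo --> v).

(* An unbounded operator is given by its domain [D] and a function [A] whose
   values outside [D] are irrelevant. *)

Definition linear_on (D : set H) (A : H -> H) : Prop :=
  [/\ D 0,
      (forall (a : R) (u v : H), D u -> D v -> D (a *: u + v)) &
      (forall (a : R) (u v : H), D u -> D v -> A (a *: u + v) = a *: A u + A v)].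

(* The left-hand side of the equivalence says that [(v, w)] belongs to the
   graph of the adjoint of [A], the right-hand side that it belongs to the
   graph of [A]. *)
Definition self_adjoint (D : set H) (A : H -> H) : Prop :=
  [/\ linear_on D A, dense D &
      forall v w : H,
        (forall u : H, D u -> ip (A u) v = ip u w) <-> (D v /\ A v = w)].

Definition positive_definite (D : set H) (A : H -> H) : Prop :=
  forall u : H, D u -> u != 0 -> 0 < ip (A u) u.

Definition compact_operator (T : H -> H) : Prop :=
  compact (closure (T @` [set x : H | `|x| <= 1])).

(* [T] is the resolvent (A - z)^-1 at some point [z] of the resolvent set. *)
Definition compact_resolvent (D : set H) (A : H -> H) : Prop :=
  exists (z : R) (T : {linear H -> H}),
    [/\ (forall v : H, D (T v) /\ A (T v) - z *: T v = v),
        (forall u : H, D u -> T (A u - z *: u) = u) &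
        compact_operator T].

Definition eigenbasis (D : set H) (A : H -> H)
    (lambda : nat -> R) (phi : nat -> H) : Prop :=
  [/\ orthonormal_basis phi,
      (forall k : nat, (1 <= k)%N -> D (phi k) /\ A (phi k) = lambda k *: phi k),
      (forall k : nat, (1 <= k)%N -> 0 < lambda k),
      (forall j k : nat, (1 <= j <= k)%N -> lambda j <= lambda k) &
      lambda @ \oo --> +oo].

(* [op_pow lambda phi s] is the operator A^s; it is meaningful on
   [dom_pow lambda phi s], where the series converges. *)
Definition dom_pow (lambda : nat -> R) (phi : nat -> H) (s : R) : set H :=
  [set v : H | (\sum_(1 <= k <oo)
     (lambda k `^ (2 * s) * `|ip v (phi k)| ^+ 2)%:E < +oo)%E].

Definition op_pow (lambda : nat -> R) (phi : nat -> H) (s : R) (v : H) : H :=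
  lim ((fun n : nat =>
     \sum_(1 <= k < n.+1) (lambda k `^ s * ip v (phi k)) *: phi k) @ \oo).

Definition has_dim (V : set H) (N : nat) : Prop :=
  exists b : 'I_N -> H,
    (forall c : 'I_N -> R, \sum_i c i *: b i = 0 -> forall i, c i = 0)
    /\ V = [set v : H | exists c : 'I_N -> R, v = \sum_i c i *: b i].

(* [V] is the approximation space and [N] its dimension; only the indices
   1, ..., N of [lambdah] and [phih] are relevant. *)
Definition discrete_eigenpairs (lambda : nat -> R) (phi : nat -> H)
    (V : set H) (N : nat) (lambdah : nat -> R) (phih : nat -> H) : Prop :=
  [/\ (forall k : nat, (1 <= k <= N)%N -> V (phih k)),
      (forall j k : nat, (1 <= j <= N)%N -> (1 <= k <= N)%N ->
         ip (phih k) (phih j) = (k == j)%:R),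
      (forall k : nat, (1 <= k <= N)%N -> forall v : H, V v ->
         ip (op_pow lambda phi 2^-1 (phih k)) (op_pow lambda phi 2^-1 v)
         = lambdah k * ip (phih k) v),
      (forall k : nat, (1 <= k <= N)%N -> 0 < lambdah k) &
      (forall j k : nat, (1 <= j <= k)%N -> (k <= N)%N ->
         lambdah j <= lambdah k)].

Definition density (m M : nat) (psi : nat -> H) (v : H) : H :=
  \sum_(m <= i < M.+1) ip v (psi i) *: psi i.

(* For bounded linear [B] the adjoint exists and is unique. *)
Definition adjoint (B : H -> H) (v : H) : H :=
  get [set w : H | forall u : H, ip (B u) v = ip u w].

(* Hilbert-Schmidt norm computed in the orthonormal basis [e]. It does not
   depend on [e], and is +oo when the operator is not Hilbert-Schmidt. *)
Definition hs_norm (e : nat -> H) (B : H -> H) : \bar R :=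
  sqrte (\sum_(1 <= k <oo) (`|B (e k)| ^+ 2)%:E)%E.

Definition residual (lambda : nat -> R) (phi : nat -> H) (G : H -> H) : H -> H :=
  let B := op_pow lambda phi 2^-1 \o G in
  fun v => B v - op_pow lambda phi (- 2^-1) (adjoint B (B v)).

Definition span_range (m M : nat) (psi : nat -> H) : set H :=
  [set v : H | exists c : nat -> R, v = \sum_(m <= i < M.+1) c i *: psi i].

(* [lamlow] is a lower bound on the eigenvalue of A with
   index M + 1. *)
Definition cluster_const (m M : nat) (lambdah : nat -> R) (lamlow : R) : R :=
  let right := (1 - lambdah M / lamlow)^-1 in
  if (1 < m)%N then Num.max (lambdah m / lambdah m.-1 - 1)^-1 right else right.

End Operators.

(* Main.v *)
(* Write u_i, mu_i for the discrete eigenpairs, a_(k,i) = (u_i, phi_k) and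
   J = [m, M].  Both density matrices and the residual have finite rank,
   Res(gamma_h) v = \sum_(i in J) (v, u_i) r_i with
   r_i = A^(1/2) u_i - mu_i A^(-1/2) u_i, so every squared Hilbert-Schmidt norm
   is a finite double sum.  In particular
   |A^(1/2) (gamma^0 - gamma_h)|^2 = T + W, where
     T = \sum_(k in J) lambda_k (1 - \sum_(i in J) a_(k,i)^2),
     W = \sum_(i in J) \sum_(k notin J) lambda_k a_(k,i)^2,
   while |Res(gamma_h)|^2 = \sum_i \sum_k (lambda_k - mu_i)^2 / lambda_k a_(k,i)^2.
   The first estimate follows from
   lambda_k <= (lambda_k - mu_i)^2 / lambda_k + 2 mu_i and Bessel's inequality.
   For the second one, T - W = \sum_(i in J) (lambda_i - mu_i) <= 0 because
   Galerkin eigenvalues bound the exact ones from above, and the gap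
   gives lambda_k <= c_h |lambda_k - mu_i| for k notin J; hence T + W <= 2 W is
   already at most 2 c_h^2 |Res(gamma_h)|^2. *)
Require Import Defs.
From HB Require Import structures.
From mathcomp Require Import all_boot all_order all_algebra.
From mathcomp Require Import sesquilinear.
From mathcomp Require Import all_classical all_reals all_analysis.
From mathcomp Require Import ring lra.

Import Order.TTheory GRing.Theory Num.Theory.
Import numFieldNormedType.Exports.

Local Open Scope classical_set_scope.
Local Open Scope ring_scope.

(** * Square roots and partial sums of series *)

Lemma powR_half_sqr {R : realType} (x : R) : 0 < x -> (x `^ 2^-1) ^+ 2 = x.
Proof.
by move=> x0; rewrite -powR_mulrn ?powR_ge0 // -powRrM mulVf // powRr1 // ltW.
Qed.

Lemma cvg_sum {R : realType} {V : normedModType R} (I : Type) (r : seq I)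
    (P : pred I) (f : nat -> I -> V) (l : I -> V) :
  (forall i, P i -> (fun n => f n i) @ \oo --> l i) ->
  (fun n => \sum_(i <- r | P i) f n i) @ \oo --> \sum_(i <- r | P i) l i.
Proof. by move=> fl; apply: cvg_big fl => //; exact: add_continuous. Qed.

Lemma cvg_nneseries {R : realType} (f : nat -> R) (l : R) :
  (fun n => \sum_(1 <= k < n.+1) f k) @ \oo --> l ->
  (\sum_(1 <= k <oo) (f k)%:E)%E = l%:E.
Proof.
(* The partial sums of an extended series stop before [n], those of the hypothesis at [n]: hence the
   shift. *)
move=> fl; apply/cvg_lim => //; rewrite -cvg_shiftS.
under eq_fun do rewrite sumEFin.
by apply: cvg_EFin => //; near=> n.
Unshelve. all: by end_near.
Qed.

Lemma cvg_nneseries_lty {R : realType} (f : nat -> R) (l : R) :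
  (fun n => \sum_(1 <= k < n.+1) f k) @ \oo --> l ->
  (\sum_(1 <= k <oo) (f k)%:E < +oo)%E.
Proof. by move=> /cvg_nneseries ->; rewrite ltry. Qed.

Lemma le_cvg_partial_sums {R : realType} (f g : nat -> R) (a b : R) :
  (fun n => \sum_(1 <= k < n.+1) f k) @ \oo --> a ->
  (fun n => \sum_(1 <= k < n.+1) g k) @ \oo --> b ->
  (forall k, (1 <= k)%N -> f k <= g k) -> a <= b.
Proof.
move=> fa gb fg; apply: ler_cvg_to fa gb _.
by near=> n; apply: ler_sum_nat => k /andP[k1 _]; exact: fg.
Unshelve. all: by end_near.
Qed.

(** The partial sums are constant from [n = M] on. Sums over the cluster thus become limits that can
    be compared term by term with full series. *)
Lemma cvg_partial_sums_restrict {R : realType} (f : nat -> R) (m M : nat) :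
  (1 <= m)%N -> (m <= M)%N ->
  (fun n => \sum_(1 <= k < n.+1) (if (m <= k < M.+1)%N then f k else 0)) @ \oo
    --> \sum_(m <= k < M.+1) f k.
Proof.
move=> m1 mM; apply: cvg_near_cst; near=> n.
have Mn : (M <= n)%N by near: n; exact: nbhs_infty_ge.
rewrite (@big_cat_nat _ _ _ m) //=; last by rewrite leqW ?(leq_trans mM).
rewrite (@big_cat_nat _ _ _ M.+1 m n.+1) //=; last exact: leqW.
rewrite big_nat big1 => [|k /andP[_ km]]; last by rewrite leqNgt km.
rewrite [X in _ + (_ + X)]big_nat [X in _ + (_ + X)]big1 => [|k /andP[Mk _]].
  rewrite add0r addr0 big_nat [RHS]big_nat.
  by apply: eq_bigr => k ->.
by rewrite (ltnNge k) Mk andbF.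
Unshelve. all: by end_near.
Qed.

(** * Inner product calculus *)

Section InnerProduct.
Context {R : realType} {H : completeNormedModType R}.
Variable ip : {dot H for idfun}.
Hypothesis ip_norm : induces_norm ip.
Implicit Types (u v w : H) (a : R).

Lemma ipC u v : ip u v = ip v u.
Proof. by rewrite hermC expr0 mul1r. Qed.

Lemma ipDl u v w : ip (u + v) w = ip u w + ip v w.
Proof. exact: linearDl. Qed.

Lemma ipDr u v w : ip u (v + w) = ip u v + ip u w.
Proof. exact: linearDr. Qed.

Lemma ipBl u v w : ip (u - v) w = ip u w - ip v w.
Proof. exact: linearBl. Qed.

Lemma ipBr u v w : ip u (v - w) = ip u v - ip u w.
Proof. exact: linearBr. Qed.

Lemma ipZl a u v : ip (a *: u) v = a * ip u v.
Proof. exact: linearZl_LR. Qed.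

Lemma ipZr a u v : ip u (a *: v) = a * ip u v.
Proof. by rewrite ipC ipZl ipC. Qed.

Lemma ip_suml I (r : seq I) (P : pred I) (F : I -> H) v :
  ip (\sum_(i <- r | P i) F i) v = \sum_(i <- r | P i) ip (F i) v.
Proof. exact: linear_sumlz. Qed.

Lemma ip_sumr I (r : seq I) (P : pred I) (F : I -> H) v :
  ip v (\sum_(i <- r | P i) F i) = \sum_(i <- r | P i) ip v (F i).
Proof. exact: linear_sumr. Qed.

Lemma ip_ge0 u : 0 <= ip u u.
Proof. by rewrite ip_norm exprn_ge0. Qed.

Lemma ip_eq0 u : ip u u = 0 -> u = 0.
Proof.
by move=> /eqP; rewrite ip_norm expf_eq0 /= normr_eq0 => /eqP.
Qed.

Lemma ip_polarization u v :
  ip u v = 4^-1 * (`|u + v| ^+ 2 - `|u - v| ^+ 2).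
Proof.
by rewrite -!ip_norm !(ipBl, ipDl, ipBr, ipDr) (ipC v u); field.
Qed.

(** Polarization reduces continuity of [ip] to continuity of the norm. *)
Lemma cvg_ip (f : nat -> H) u v :
  f @ \oo --> u -> (fun n => ip (f n) v) @ \oo --> ip u v.
Proof.
move=> fu; rewrite ip_polarization.
under eq_fun do rewrite ip_polarization.
apply: cvgM; first exact: cvg_cst.
by apply: cvgB; apply: (cvgM (f := fun n => `|_ : H|) (g := fun n => `|_ : H|));
  apply: cvg_norm; (apply: cvgD || apply: cvgB) => //; exact: cvg_cst.
Qed.

(** * Parseval and Riesz-Fischer *)

Section OrthonormalBasis.
Variable e : nat -> H.
Hypothesis e_basis : orthonormal_basis ip e.

Lemma orthonormal_ip j k : (1 <= j)%N -> (1 <= k)%N ->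
  ip (e j) (e k) = (j == k)%:R.
Proof. by case: e_basis => + _; exact. Qed.

Lemma parseval v w :
  (fun n => \sum_(1 <= k < n.+1) ip v (e k) * ip w (e k)) @ \oo --> ip v w.
Proof.
have := cvg_ip _ _ w (proj2 e_basis v).
under eq_fun do rewrite ip_suml.
by under eq_fun do under eq_bigr do rewrite ipZl (ipC (e _)).
Qed.

Lemma ip_basis_inj v w :
  (forall k, (1 <= k)%N -> ip v (e k) = ip w (e k)) -> v = w.
Proof.
move=> vw; apply/subr0_eq/ip_eq0.
apply: (cvg_unique _ (parseval (v - w) (v - w))) => //.
apply: cvg_near_cst; near=> n; rewrite big_nat big1 // => k /andP[k1 _].
by rewrite ipBl vw // subrr mul0r.
Unshelve. all: by end_near.
Qed.

(** By orthonormality, the squared norm of a block of the vector series is the same block of the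
    series of squares. The Cauchy criterion passes from squares to vectors, and completeness yields
    [w]. *)
Lemma riesz_fischer (c : nat -> R) :
  (\sum_(1 <= k <oo) (c k ^+ 2)%:E < +oo)%E ->
  exists2 w : H,
    (fun n => \sum_(1 <= k < n.+1) c k *: e k) @ \oo --> w &
    forall k, (1 <= k)%N -> ip w (e k) = c k.
Proof.
move=> c_fin.
have sq : cvg (series (fun k => c k.+1 ^+ 2) @ \oo).
  apply: nnseries_is_cvg => [k|]; first exact: sqr_ge0.
  apply: le_lt_trans c_fin.
  rewrite -(@nneseries_addn R (fun k => (c k ^+ 2)%:E) 1) => [|k].
    by under[X in (_ <= X)%E] eq_eseriesr do rewrite addn1.
  by rewrite lee_fin sqr_ge0.
have /cauchy_cvgP/cauchy_seriesP sq_cauchy := sq.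
have : cvg (series (fun k => c k.+1 *: e k.+1) @ \oo).
  apply/cauchy_cvgP/cauchy_seriesP => d d0.
  (* Tolerance [d ^+ 2] for the squares gives tolerance [d] for the norms. *)
  have := sq_cauchy _ (exprn_gt0 2 d0); apply: filterS => -[p q] /=.
  rewrite ger0_norm ?sumr_ge0 // => [|k _]; last exact: sqr_ge0.
  move=> lt_d; rewrite -(@ltr_pXn2r _ 2) ?nnegrE // ?(ltW d0) //.
  apply: le_lt_trans lt_d; rewrite -ip_norm ip_suml.
  apply: ler_sum_nat => k /andP[pk kq].
  rewrite ip_sumr (bigD1_seq k) ?iota_uniq ?mem_index_iota ?pk //=.
  rewrite big1 ?addr0 => [|j jk].
    by rewrite ipZl ipZr orthonormal_ip // eqxx mulr1 expr2.
  by rewrite ipZl ipZr orthonormal_ip // eqSS eq_sym (negPf jk) !mulr0.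
have -> : series (fun k => c k.+1 *: e k.+1)
    = (fun n => \sum_(1 <= k < n.+1) c k *: e k).
  by apply/funext => n; rewrite big_add1.
move=> /cvg_ex[/= w cw]; exists w => // k k1.
(* The [k]-th coordinate of the partial sums equals [c k] as soon as [n >= k]. *)
apply: (cvg_unique _ (cvg_ip _ _ (e k) cw)) => //; apply: cvg_near_cst.
near=> n; have kn : (k <= n)%N by near: n; exact: nbhs_infty_ge.
rewrite ip_suml (bigD1_seq k) ?iota_uniq ?mem_index_iota ?k1 //=.
rewrite ipZl orthonormal_ip // eqxx mulr1 big_seq_cond big1 ?addr0 // => j.
rewrite mem_index_iota => /andP[/andP[j1 _] jk].
by rewrite ipZl orthonormal_ip // (negPf jk) mulr0.
Unshelve. all: by end_near.
Qed.

End OrthonormalBasis.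

(** * Finite-rank operators and Bessel's inequality *)

(** Every operator in the theorem is brought to this form, or to a difference of two such. *)
Definition rank_sum (m M : nat) (x y : nat -> H) (v : H) : H :=
  \sum_(m <= i < M.+1) ip v (x i) *: y i.

Definition orthonormal_on (m M : nat) (x : nat -> H) : Prop :=
  forall i j, (m <= i < M.+1)%N -> (m <= j < M.+1)%N ->
    ip (x i) (x j) = (i == j)%:R.

Lemma sum_orthonormal_on m M x (F : nat -> nat -> R) : orthonormal_on m M x ->
  \sum_(m <= i < M.+1) \sum_(m <= j < M.+1) ip (x i) (x j) * F i j
  = \sum_(m <= i < M.+1) F i i.
Proof.
move=> x_on; apply: eq_big_nat => i imM.
rewrite (bigD1_seq i) ?iota_uniq ?mem_index_iota //= x_on // eqxx mul1r.
rewrite big_seq_cond big1 ?addr0 // => j.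
rewrite mem_index_iota => /andP[jmM ji].
by rewrite x_on // eq_sym (negPf ji) mul0r.
Qed.

(** Subtracting from [v] its projection [p] onto the span of the [x i] leaves a vector whose squared
    norm is the difference of the two sides. *)
Lemma bessel m M x v : orthonormal_on m M x ->
  \sum_(m <= i < M.+1) ip v (x i) ^+ 2 <= ip v v.
Proof.
move=> x_on; rewrite -subr_ge0.
set S := \sum_(_ <= i < _) _.
pose p := rank_sum m M x x v.
have vp : ip v p = S.
  by rewrite ip_sumr; apply: eq_bigr => i _; rewrite ipZr expr2.
have pp : ip p p = S.
  rewrite /S; under eq_bigr do rewrite expr2.
  rewrite ip_suml -(sum_orthonormal_on _ _ _ (fun i j => ip v (x i) * ip v (x j)) x_on).
  apply: eq_bigr => i _; rewrite ipZl ip_sumr mulr_sumr.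
  by apply: eq_bigr => j _; rewrite ipZr; ring.
have := ip_ge0 (v - p).
by rewrite !(ipBl, ipBr) (ipC p v) vp pp subrr subr0.
Qed.

(** * Hilbert-Schmidt norms of finite-rank operators *)

Section HilbertSchmidt.
Variable e : nat -> H.
Hypothesis e_basis : orthonormal_basis ip e.

(** The limit is a Hilbert-Schmidt inner product; Parseval for each pair [x i], [x' j] removes [e]
    from the result. *)
Lemma cvg_hs_ip_rank_sum m M x y x' y' :
  (fun n => \sum_(1 <= k < n.+1)
     ip (rank_sum m M x y (e k)) (rank_sum m M x' y' (e k))) @ \oo -->
  \sum_(m <= i < M.+1) \sum_(m <= j < M.+1) ip (x i) (x' j) * ip (y i) (y' j).
Proof.
have -> : (fun n => \sum_(1 <= k < n.+1)
     ip (rank_sum m M x y (e k)) (rank_sum m M x' y' (e k))) =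
  (fun n => \sum_(m <= i < M.+1) \sum_(m <= j < M.+1)
     (\sum_(1 <= k < n.+1) ip (x i) (e k) * ip (x' j) (e k)) * ip (y i) (y' j)).
  apply/funext => n; under eq_bigr do rewrite ip_suml.
  rewrite exchange_big; apply: eq_bigr => i _ /=.
  under eq_bigr do rewrite ip_sumr; rewrite exchange_big; apply: eq_bigr => j _ /=.
  rewrite mulr_suml; apply: eq_bigr => k _.
  by rewrite ipZl ipZr (ipC (x i)) (ipC (x' j)); ring.
apply: cvg_sum => i _; apply: cvg_sum => j _.
by apply: cvgM (cvg_cst _); exact: parseval.
Qed.

Lemma hs_norm_sqr (B : H -> H) (l : R) :
  (fun n => \sum_(1 <= k < n.+1) `|B (e k)| ^+ 2) @ \oo --> l ->
  (hs_norm e B ^+ 2 = l%:E)%E.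
Proof.
move=> Bl; rewrite /hs_norm sqr_sqrte ?(cvg_nneseries _ _ Bl) //.
rewrite -(cvg_nneseries _ _ Bl); apply: nneseries_ge0 => k _ _.
by rewrite lee_fin sqr_ge0.
Qed.

Lemma hs_norm_rank_sum m M x y (B : H -> H) : orthonormal_on m M x ->
  (forall v, B v = rank_sum m M x y v) ->
  (hs_norm e B ^+ 2 = (\sum_(m <= i < M.+1) ip (y i) (y i))%:E)%E.
Proof.
move=> x_on BE; apply: hs_norm_sqr.
(* The diagonal sum is expanded against the Gram matrix of [x] to match the form of the limit. *)
rewrite -(sum_orthonormal_on _ _ _ (fun i j => ip (y i) (y j)) x_on).
under eq_fun do under eq_bigr do rewrite BE -ip_norm.
exact: cvg_hs_ip_rank_sum.
Qed.

Lemma hs_norm_rank_sumB m M x y x' y' (B : H -> H) :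
  orthonormal_on m M x -> orthonormal_on m M x' ->
  (forall v, B v = rank_sum m M x y v - rank_sum m M x' y' v) ->
  (hs_norm e B ^+ 2 =
   (\sum_(m <= i < M.+1) ip (y i) (y i) + \sum_(m <= i < M.+1) ip (y' i) (y' i)
    - 2 * \sum_(m <= i < M.+1) \sum_(m <= j < M.+1)
            ip (x i) (x' j) * ip (y i) (y' j))%:E)%E.
Proof.
move=> x_on x'_on BE; apply: hs_norm_sqr.
rewrite -(sum_orthonormal_on _ _ _ (fun i j => ip (y i) (y j)) x_on).
rewrite -(sum_orthonormal_on _ _ _ (fun i j => ip (y' i) (y' j)) x'_on).
under eq_fun => n.
  have -> : \sum_(1 <= k < n.+1) `|B (e k)| ^+ 2 =
    \sum_(1 <= k < n.+1) ip (rank_sum m M x y (e k)) (rank_sum m M x y (e k))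
    + \sum_(1 <= k < n.+1) ip (rank_sum m M x' y' (e k)) (rank_sum m M x' y' (e k))
    - 2 * \sum_(1 <= k < n.+1)
            ip (rank_sum m M x y (e k)) (rank_sum m M x' y' (e k)).
    rewrite mulr_sumr -big_split -sumrB; apply: eq_bigr => k _ /=.
    rewrite BE -ip_norm !(ipBl, ipBr).
    by rewrite [ip (rank_sum _ _ x' _ _) (rank_sum _ _ x _ _)]ipC; ring.
  over.
apply: cvgB; first by apply: cvgD; exact: cvg_hs_ip_rank_sum.
by apply: cvgM; [exact: cvg_cst | exact: cvg_hs_ip_rank_sum].
Qed.

End HilbertSchmidt.

(** Taking adjoints swaps the two families; definiteness of [ip] makes the adjoint unique, so [get]
    returns it. *)
Lemma adjoint_rank_sum m M x y (B : H -> H) w :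
  (forall v, B v = rank_sum m M x y v) ->
  adjoint ip B w = rank_sum m M y x w.
Proof.
move=> BE; have BA u : ip (B u) w = ip u (rank_sum m M y x w).
  rewrite BE ip_suml ip_sumr; apply: eq_bigr => i _.
  by rewrite ipZl ipZr (ipC w) mulrC.
apply: get_unique => // w' Bw'; apply/subr0_eq/ip_eq0.
by rewrite ipBr -Bw' BA subrr.
Qed.

(** * Powers of A in eigenbasis coordinates *)

Section Powers.
Variables (lambda : nat -> R) (phi : nat -> H).
Hypothesis phi_basis : orthonormal_basis ip phi.
Hypothesis lambda_gt0 : forall k, (1 <= k)%N -> 0 < lambda k.

(* No domain condition: [w] itself certifies the convergence of the series. *)
Lemma op_pow_eq s v w :
  (forall k, (1 <= k)%N -> ip w (phi k) = lambda k `^ s * ip v (phi k)) ->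
  op_pow ip lambda phi s v = w.
Proof.
move=> wv; apply/cvg_lim => //.
have := proj2 phi_basis w; apply: cvg_trans; apply: near_eq_cvg; near=> n.
by apply: eq_big_nat => k /andP[k1 _]; rewrite wv.
Unshelve. all: by end_near.
Qed.

(** On the domain, Riesz-Fischer supplies a vector with these coordinates, and [op_pow_eq]
    identifies it with the limit. *)
Lemma ip_op_pow s v k : dom_pow ip lambda phi s v -> (1 <= k)%N ->
  ip (op_pow ip lambda phi s v) (phi k) = lambda k `^ s * ip v (phi k).
Proof.
move=> v_dom; have [|w _ wE] := riesz_fischer _ phi_basis
  (fun k => lambda k `^ s * ip v (phi k)).
  apply: le_lt_trans v_dom; apply: lee_nneseries => [i _ _ | i _].
    by rewrite lee_fin sqr_ge0.
  rewrite lee_fin exprMn real_normK ?num_real // (mulrC 2) powRrM powR_mulrn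
    ?powR_ge0 //.
move: k; by rewrite (op_pow_eq _ _ _ wE) => k /wE.
Qed.

(** Negative powers are bounded: the weights are largest at [k = 1], and Parseval sums the rest. *)
Lemma dom_pow_oppr s v : 0 <= s ->
  (forall k, (1 <= k)%N -> lambda 1 <= lambda k) -> dom_pow ip lambda phi (- s) v.
Proof.
move=> s0 lambda_ge; rewrite /dom_pow /=.
apply: (@le_lt_trans _ _ (\sum_(1 <= k <oo) (lambda 1 `^ (2 * - s) * ip v (phi k) ^+ 2)%:E)%E).
  (* After the shift, the termwise bound is only asked at indices at least 1, where [lambda] is
     controlled. *)
  rewrite -!(@nneseries_addn _ _ 1); try by
    move=> k; rewrite lee_fin mulr_ge0 ?powR_ge0 ?sqr_ge0.
  apply: lee_nneseries => [k _ _|k _].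
    by rewrite lee_fin mulr_ge0 ?powR_ge0 ?sqr_ge0.
  have k1 : (1 <= k + 1)%N by rewrite addn1.
  rewrite lee_fin real_normK ?num_real // ler_wpM2r ?sqr_ge0 //.
  rewrite mulrN !powRN lef_pV2 ?posrE ?powR_gt0 ?lambda_gt0 //.
  by rewrite ge0_ler_powR ?nnegrE ?mulr_ge0 ?(ltW (lambda_gt0 _ _)) ?lambda_ge.
apply: (@cvg_nneseries_lty _ _ (lambda 1 `^ (2 * - s) * ip v v)).
under eq_fun do rewrite -mulr_sumr.
by apply: cvgM; [exact: cvg_cst | exact: parseval].
Qed.

Lemma cvg_op_pow_half v : dom_pow ip lambda phi 2^-1 v ->
  (fun n => \sum_(1 <= k < n.+1) lambda k * ip v (phi k) ^+ 2) @ \oo -->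
  ip (op_pow ip lambda phi 2^-1 v) (op_pow ip lambda phi 2^-1 v).
Proof.
move=> v_dom; set w := op_pow _ _ _ _ _.
have := parseval _ phi_basis w w; apply: cvg_trans; apply: near_eq_cvg; near=> n.
apply: eq_big_nat => k /andP[k1 _]; rewrite ip_op_pow //.
by rewrite -expr2 exprMn powR_half_sqr ?lambda_gt0.
Unshelve. all: by end_near.
Qed.

(** * Galerkin eigenpairs *)

Section Galerkin.
Variables (N : nat) (mu : nat -> R) (u : nat -> H).
Hypothesis lambda_ndecr :
  forall j k, (1 <= j <= k)%N -> lambda j <= lambda k.
Hypothesis u_orthonormal : orthonormal_on 1 N u.
Hypothesis u_dom : forall i, (1 <= i < N.+1)%N -> dom_pow ip lambda phi 2^-1 (u i).
Hypothesis mu_ndecr : forall j k, (1 <= j <= k)%N -> (k < N.+1)%N -> mu j <= mu k.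
Hypothesis galerkin : forall i j, (1 <= i < N.+1)%N -> (1 <= j < N.+1)%N ->
  ip (op_pow ip lambda phi 2^-1 (u i)) (op_pow ip lambda phi 2^-1 (u j))
  = mu i * ip (u i) (u j).

Local Notation sqrtA := (op_pow ip lambda phi 2^-1).
Local Notation invsqrtA := (op_pow ip lambda phi (- 2^-1)).

(* Otherwise a nonzero combination of [u 1, ..., u k] orthogonal to
   [phi 1, ..., phi k.-1] has Rayleigh quotient both [<= mu k] and
   [>= lambda k]. *)
Lemma eigenvalue_le_galerkin k : (1 <= k < N.+1)%N -> lambda k <= mu k.
Proof.
move=> kN; rewrite leNgt; apply/negP => mu_lt.
have k1 : (1 <= k)%N by case/andP: kN.
have iN (i : 'I_k) : (1 <= i.+1 < N.+1)%N.
  by rewrite /= ltnS (leq_trans (ltn_ord i)) //; case/andP: kN.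
(* [X] has more rows than columns, so proving it row-free is absurd. A vector in its left kernel
   gives a combination orthogonal to the first [k.-1] eigenvectors. *)
pose X : 'M[R]_(k, k.-1) := \matrix_(i, j) ip (u i.+1) (phi j.+1).
suff /eqP rkX : row_free X by have := rank_leq_col X; rewrite rkX leqNgt
  ltn_predL k1.
apply: inj_row_free => v vX.
pose w := \sum_i v 0 i *: u i.+1.
(* [z] plays the role of [sqrtA w]; [zE] checks this on coordinates. *)
pose z := \sum_i v 0 i *: sqrtA (u i.+1).
have w_orth j : (1 <= j < k)%N -> ip w (phi j) = 0.
  case: j => // j /andP[_ jk]; have jk' : (j < k.-1)%N by rewrite -ltnS prednK.
  have /matrixP/(_ 0 (Ordinal jk')) := vX; rewrite !mxE => vX0.
  by rewrite ip_suml -[RHS]vX0; apply: eq_bigr => i _; rewrite ipZl mxE.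
have zE j : (1 <= j)%N -> ip z (phi j) = lambda j `^ 2^-1 * ip w (phi j).
  move=> j1; rewrite !ip_suml mulr_sumr; apply: eq_bigr => i _.
  by rewrite !ipZl ip_op_pow //; [ring | exact: u_dom].
have wE : ip w w = \sum_i v 0 i ^+ 2.
  rewrite ip_suml; apply: eq_bigr => i _; rewrite ip_sumr (bigD1 i) //= big1.
    by rewrite addr0 ipZl ipZr u_orthonormal // eqxx mulr1 expr2.
  by move=> j ji; rewrite ipZl ipZr u_orthonormal // eqSS val_eqE eq_sym
    (negPf ji) !mulr0.
have zz : ip z z <= mu k * ip w w.
  rewrite wE mulr_sumr ip_suml; apply: ler_sum => i _; rewrite ip_sumr (bigD1 i)
    //= big1.
    rewrite addr0 ipZl ipZr galerkin // u_orthonormal // eqxx mulr1.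
    rewrite mulrA -expr2 mulrC ler_wpM2r ?sqr_ge0 //.
    by apply: mu_ndecr; [rewrite /= ltn_ord | case/andP: kN].
  by move=> j ji; rewrite ipZl ipZr galerkin // u_orthonormal // eqSS val_eqE
    eq_sym (negPf ji) !mulr0.
have ww : lambda k * ip w w <= ip z z.
  have cw := parseval _ phi_basis w w; have cz := parseval _ phi_basis z z.
  apply: (@le_cvg_partial_sums _ (fun j => lambda k * (ip w (phi j) * ip w (phi j)))
    _ _ _ _ cz).
    by under eq_fun do rewrite -mulr_sumr; apply: cvgM cw; exact: cvg_cst.
  move=> j j1; have [jk|kj] := ltnP j k; first by rewrite w_orth ?j1 // !mul0r
    mulr0 sqr_ge0.
  rewrite zE // -!expr2 exprMn powR_half_sqr ?lambda_gt0 //.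
  by rewrite ler_wpM2r ?sqr_ge0 // lambda_ndecr ?k1.
have w0 : ip w w = 0.
  apply/eqP; rewrite eq_le ip_ge0 andbT -(pmulr_rle0 _ (_ : 0 < lambda k - mu k))
    ?subr_gt0 //.
  by rewrite mulrBl subr_le0 (le_trans ww).
apply/rowP => i; rewrite mxE; apply/eqP; rewrite -sqrf_eq0.
by have /eqP := w0; rewrite wE psumr_eq0 => [/allP/(_ i (mem_index_enum _))|? _];
  rewrite ?sqr_ge0.
Qed.

(** Formally A^(-1/2) (A u_i - mu_i u_i): the residual of the eigenvalue equation in the dual energy
    norm. *)
Definition residual_vector i : H := sqrtA (u i) - mu i *: invsqrtA (u i).

Lemma cvg_residual_vector i : (1 <= i < N.+1)%N ->
  (fun n => \sum_(1 <= k < n.+1)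
     (lambda k - mu i) ^+ 2 / lambda k * ip (u i) (phi k) ^+ 2) @ \oo -->
  ip (residual_vector i) (residual_vector i).
Proof.
move=> iN; have := parseval _ phi_basis (residual_vector i) (residual_vector i).
apply: cvg_trans; apply: near_eq_cvg; near=> n.
apply: eq_big_nat => k /andP[k1 _]; rewrite ipBl ipZl !ip_op_pow //; last 2 first.
- by apply: dom_pow_oppr => // j j1; exact: lambda_ndecr.
- exact: u_dom.
have l0 := lambda_gt0 _ k1; rewrite powRN.
have := powR_half_sqr _ l0; have := powR_gt0 2^-1 l0.
(* With [lambda k] written as [p ^+ 2], the identity is rational. *)
by move: (lambda k `^ 2^-1) => p p0 <-; field; rewrite gt_eqF.
Unshelve. all: by end_near.
Qed.

(** * Energy of the discrete eigenvectors outside the cluster *)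

Section Cluster.
Variables (m M : nat).
Hypothesis m_ge1 : (1 <= m)%N.
Hypothesis m_leM : (m <= M)%N.

(* [leak i] is the sum of [lambda k * ip (u i) (phi k) ^+ 2] over the [k] outside
   of the cluster; see [cvg_leak]. *)
Local Notation leak i :=
  (mu i - \sum_(m <= k < M.+1) lambda k * ip (u i) (phi k) ^+ 2).

Lemma cvg_leak i : (1 <= i < N.+1)%N ->
  (fun n => \sum_(1 <= k < n.+1) (lambda k * ip (u i) (phi k) ^+ 2
    - (if (m <= k < M.+1)%N then lambda k * ip (u i) (phi k) ^+ 2 else 0))) @ \oo
  --> leak i.
Proof.
move=> iN; under eq_fun do rewrite sumrB.
(* The Galerkin relation tested on [u i] itself makes [mu i] its total energy. *)
have -> : mu i = ip (sqrtA (u i)) (sqrtA (u i)).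
  by rewrite galerkin // u_orthonormal // eqxx mulr1.
apply: cvgB; last exact: cvg_partial_sums_restrict.
by apply: cvg_op_pow_half; exact: u_dom.
Qed.

(** Outside the cluster the termwise bound has slack mu_i^2 / lambda_k; inside, its left side
    vanishes. The last factor is the mass of [u i] outside the cluster. *)
Lemma leak_le_residual i : (1 <= i < N.+1)%N ->
  leak i <= ip (residual_vector i) (residual_vector i)
    + 2 * mu i * (1 - \sum_(m <= k < M.+1) ip (u i) (phi k) ^+ 2).
Proof.
move=> iN; have := cvg_leak _ iN.
have gap : (fun n => \sum_(1 <= k < n.+1)
    ((lambda k - mu i) ^+ 2 / lambda k * ip (u i) (phi k) ^+ 2 + 2 * mu i *
     (ip (u i) (phi k) * ip (u i) (phi k)
      - (if (m <= k < M.+1)%N then ip (u i) (phi k) ^+ 2 else 0)))) @ \oo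
  --> ip (residual_vector i) (residual_vector i)
    + 2 * mu i * (1 - \sum_(m <= k < M.+1) ip (u i) (phi k) ^+ 2).
  under eq_fun do rewrite big_split /= -mulr_sumr sumrB.
  apply: cvgD; first exact: cvg_residual_vector.
  apply: cvgM; first exact: cvg_cst.
  apply: cvgB; last exact: cvg_partial_sums_restrict.
  have <- : ip (u i) (u i) = 1 by rewrite u_orthonormal // eqxx.
  exact: parseval.
move=> /le_cvg_partial_sums/(_ gap); apply => k k1; case: ifP => _.
  rewrite -expr2 !subrr mulr0 addr0 mulr_ge0 ?sqr_ge0 // divr_ge0 ?sqr_ge0 //.
  exact/ltW/lambda_gt0.
have l0 := lambda_gt0 _ k1.
rewrite !subr0 -expr2 -mulrDl ler_wpM2r ?sqr_ge0 //.
have -> : (lambda k - mu i) ^+ 2 / lambda k + 2 * mu i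
    = lambda k + mu i ^+ 2 / lambda k by field; rewrite gt_eqF.
by rewrite lerDl divr_ge0 ?sqr_ge0 // ltW.
Qed.

(** Squaring the gap hypothesis and dividing by [lambda k] gives the bound term by term. *)
Lemma leak_le_gap_residual i (c : R) : (1 <= i < N.+1)%N ->
  (forall k, (1 <= k)%N -> ~~ (m <= k < M.+1)%N ->
     lambda k <= c * `|lambda k - mu i|) ->
  leak i <= c ^+ 2 * ip (residual_vector i) (residual_vector i).
Proof.
move=> iN gap; have := cvg_leak _ iN.
have cres : (fun n => \sum_(1 <= k < n.+1)
    c ^+ 2 * ((lambda k - mu i) ^+ 2 / lambda k * ip (u i) (phi k) ^+ 2)) @ \oo
  --> c ^+ 2 * ip (residual_vector i) (residual_vector i).
  under eq_fun do rewrite -mulr_sumr.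
  by apply: cvgM; [exact: cvg_cst | exact: cvg_residual_vector].
move=> /le_cvg_partial_sums/(_ cres); apply => k k1; have l0 := lambda_gt0 _ k1.
case: ifPn => [_|/(gap _ k1) le_gap].
  by rewrite subrr mulr_ge0 ?sqr_ge0 // mulr_ge0 ?divr_ge0 ?sqr_ge0 // ltW.
rewrite subr0 mulrA ler_wpM2r ?sqr_ge0 // mulrA ler_pdivlMr // -expr2.
rewrite -[X in _ * X]real_normK ?num_real // -exprMn.
by rewrite ler_pXn2r // nnegrE ?(ltW l0) // (le_trans (ltW l0)).
Qed.

End Cluster.
End Galerkin.
End Powers.
End InnerProduct.

(** * Scalar inequalities *)

(** Here [a i j] stands for (u_j, phi_i)^2. The left side splits as (L - T) + (U - T); row sums
    control the first part, column sums and the leak bound the second. *)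
Lemma cluster_error_le {R : realDomainType} (m M : nat) (a : nat -> nat -> R)
    (lambda mu rho : nat -> R) (lM muM : R) :
  0 <= lM ->
  (forall i, (m <= i < M.+1)%N -> lambda i <= lM) ->
  (forall i, (m <= i < M.+1)%N -> mu i <= muM) ->
  (forall i, (m <= i < M.+1)%N -> \sum_(m <= j < M.+1) a i j <= 1) ->
  (forall j, (m <= j < M.+1)%N -> \sum_(m <= i < M.+1) a i j <= 1) ->
  (forall j, (m <= j < M.+1)%N ->
     mu j - \sum_(m <= i < M.+1) lambda i * a i j
     <= rho j + 2 * mu j * (1 - \sum_(m <= i < M.+1) a i j)) ->
  \sum_(m <= i < M.+1) lambda i + \sum_(m <= j < M.+1) mu j
    - 2 * \sum_(m <= i < M.+1) \sum_(m <= j < M.+1) lambda i * a i j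
  <= \sum_(m <= j < M.+1) rho j
    + (lM + muM) * (\sum_(m <= i < M.+1) 1 + \sum_(m <= i < M.+1) 1
        - 2 * \sum_(m <= i < M.+1) \sum_(m <= j < M.+1) a i j).
Proof.
move=> lM0 l_le mu_le row_le col_le leak_le.
set L := \sum_(_ <= _ < _) lambda _; set U := \sum_(_ <= _ < _) mu _.
set n := \sum_(_ <= _ < _) 1; set rhos := \sum_(_ <= _ < _) rho _.
set S := \sum_(_ <= i < _) \sum_(_ <= j < _) a i j.
set T := \sum_(_ <= i < _) \sum_(_ <= j < _) lambda i * a i j.
have phi_part : L - T <= lM * (n - S).
  rewrite -!sumrB mulr_sumr; apply: ler_sum_nat => i iJ.
  by rewrite -mulr_sumr -{1}[lambda i]mulr1 -mulrBr ler_wpM2r ?subr_ge0 ?l_le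
    ?row_le.
have u_part : U - T <= rhos + 2 * muM * (n - S).
  rewrite /T /S exchange_big [in X in _ <= X]exchange_big /=.
  rewrite -!sumrB mulr_sumr -big_split /=; apply: ler_sum_nat => j jJ.
  apply: le_trans (leak_le _ jJ) _; rewrite lerD2l ler_wpM2r ?subr_ge0 ?col_le //.
  by rewrite ler_wpM2l ?mu_le.
(* The two parts use [lM] once, while the squared distance [2 * (n - S)] carries it twice; the
   surplus is nonnegative. *)
have S_le : 0 <= lM * (n - S).
  by rewrite mulr_ge0 // -sumrB big_nat sumr_ge0 // => i iJ; rewrite subr_ge0
    row_le.
nra.
Qed.

(** The ratio l / (l - mu) decreases in [l] and increases in [mu], so the worst case is [low],
    [muM]. *)
Lemma le_gap_above {R : realFieldType} (mu muM low l : R) :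
  0 < mu -> mu <= muM -> muM < low -> low <= l ->
  l <= (1 - muM / low)^-1 * (l - mu).
Proof.
move=> mu0 mu_le mu_lt low_le.
have -> : (1 - muM / low)^-1 = low / (low - muM).
  by field; apply/andP; split; lra.
rewrite mulrAC ler_pdivlMr ?subr_gt0 //; nra.
Qed.

(** The ratio l / (mu - l) increases in [l] and decreases in [mu], so the worst case is [p],
    [mum]. *)
Lemma le_gap_below {R : realFieldType} (mu mum p l : R) :
  0 < l -> l <= p -> p < mum -> mum <= mu ->
  l <= (mum / p - 1)^-1 * (mu - l).
Proof.
move=> l0 l_le p_lt mum_le.
have -> : (mum / p - 1)^-1 = p / (mum - p).
  by field; apply/andP; split; lra.
rewrite mulrAC ler_pdivlMr ?subr_gt0 //; nra.
Qed.

(** * Assembly of the two estimates *)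

Theorem theorem4p5 (R : realType) (H : completeNormedModType R)
    (ip : {dot H for idfun}) (ip_norm : induces_norm ip)
    (H_separable : separable H)
    (D : set H) (A : H -> H)
    (A_self_adjoint : self_adjoint ip D A)
    (A_positive : positive_definite ip D A)
    (A_resolvent : compact_resolvent D A)
    (lambda : nat -> R) (phi : nat -> H)
    (A_eigen : eigenbasis ip D A lambda phi)
    (m M : nat) (m_ge1 : (1 <= m)%N) (m_leM : (m <= M)%N)
    (Vh : set H) (N : nat) (Vh_dim : has_dim Vh N) (M_leN : (M <= N)%N)
    (Vh_dom : Vh `<=` dom_pow ip lambda phi 2^-1)
    (lambdah : nat -> R) (phih : nat -> H)
    (Vh_eigen : discrete_eigenpairs ip lambda phi Vh N lambdah phih)
    (e : nat -> H) (e_basis : orthonormal_basis ip e)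
    (gap_low : (1 < m)%N -> lambda m.-1 < lambda m)
    (gap_high : lambda M < lambda M.+1) :
  let sqrtA := op_pow ip lambda phi 2^-1 in
  let gamma0 := density ip m M phi in
  let gammah := density ip m M phih in
  let Res := residual ip lambda phi gammah in
  (hs_norm e (fun v => sqrtA (gamma0 v - gammah v)%R) ^+ 2
     <= hs_norm e Res ^+ 2
        + (lambda M + lambdah M)%:E
          * hs_norm e (fun v => gamma0 v - gammah v)%R ^+ 2)%E
  /\
  ((forall v : H, span_range m M phi v -> v != 0 -> `|gammah v| != 0) ->
   forall lamlow : R,
   ((1 < m)%N ->
      lambda m.-1 <= lambdah m.-1 /\ lambdah m.-1 < lambdah m) ->
   lambdah M < lamlow -> lamlow <= lambda M.+1 ->
   (hs_norm e (fun v => sqrtA (gamma0 v - gammah v)%R) ^+ 2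
      <= (2 * cluster_const m M lambdah lamlow ^+ 2)%:E
           * hs_norm e Res ^+ 2
         + (lambda M / 2)%:E
           * hs_norm e (fun v => gamma0 v - gammah v)%R ^+ 4)%E).
Proof.
move=> sqrtA gamma0 gammah Res.
have [phi_basis _ lambda_gt0 lambda_ndecr _] := A_eigen.
have [u_V u_on galerkin mu_gt0 mu_ndecr] := Vh_eigen.
have phi_on : orthonormal_on ip m M phi.
  move=> i j /andP[mi _] /andP[mj _].
  by apply: orthonormal_ip phi_basis _ _ _ _; exact: leq_trans m_ge1 _.
have uN_on : orthonormal_on ip 1 N phih by move=> i j iN jN; exact: u_on.
have JN i : (m <= i < M.+1)%N -> (1 <= i < N.+1)%N.
  move=> /andP[mi iM]; rewrite (leq_trans m_ge1 mi) /= ltnS.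
  exact: leq_trans M_leN.
have J1 i : (m <= i < M.+1)%N -> (1 <= i)%N by move=> /JN/andP[].
have uJ_on : orthonormal_on ip m M phih by move=> i j /JN iN /JN jN; exact: u_on.
have u_dom i : (1 <= i < N.+1)%N -> dom_pow ip lambda phi 2^-1 (phih i).
  by move=> iN; apply/Vh_dom/u_V.
have gal i j : (1 <= i < N.+1)%N -> (1 <= j < N.+1)%N ->
    ip (sqrtA (phih i)) (sqrtA (phih j)) = lambdah i * ip (phih i) (phih j).
  by move=> iN jN; apply: galerkin => //; exact: u_V.
have mu_le j k : (1 <= j <= k)%N -> (k < N.+1)%N -> lambdah j <= lambdah k.
  exact: mu_ndecr.
have sqrtA_phi i : (m <= i < M.+1)%N -> sqrtA (phi i) = lambda i `^ 2^-1 *: phi i.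
  move=> /J1 i1; apply: op_pow_eq => // k k1.
  rewrite (ipZl ip) (orthonormal_ip ip phi phi_basis) //.
  by case: eqVneq => [->|]; rewrite ?mulr0.
have sqrtA_u i k : (m <= i < M.+1)%N -> (1 <= k)%N ->
    ip (sqrtA (phih i)) (phi k) = lambda k `^ 2^-1 * ip (phih i) (phi k).
  by move=> /JN iN k1; apply: ip_op_pow => //; exact: u_dom.
(* Comparing coordinates in [phi] moves [sqrtA] inside the finite sum without appeal to linearity of
   [op_pow]. *)
have gammahE v : (sqrtA \o gammah) v = rank_sum ip m M phih (sqrtA \o phih) v.
  apply: op_pow_eq => // k k1; rewrite !(ip_suml ip) mulr_sumr.
  by apply: eq_big_nat => i iJ; rewrite !(ipZl ip) /= sqrtA_u //; ring.
have diffE v : sqrtA (gamma0 v - gammah v) =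
    rank_sum ip m M phi (sqrtA \o phi) v - rank_sum ip m M phih (sqrtA \o phih) v.
  apply: op_pow_eq => // k k1; rewrite !(ipBl ip) mulrBr !(ip_suml ip) !mulr_sumr.
  congr (_ - _); apply: eq_big_nat => i iJ /=; rewrite !(ipZl ip).
    rewrite sqrtA_phi // (ipZl ip) (orthonormal_ip ip phi phi_basis) //
      ?(J1 _ iJ) //.
    by case: eqVneq => [->|]; rewrite ?mulr0 // !mulr1 mulrC.
  by rewrite sqrtA_u //; ring.
have ResE v : Res v =
    rank_sum ip m M phih (residual_vector ip lambda phi lambdah phih) v.
  rewrite /Res /residual (adjoint_rank_sum ip ip_norm _ _ _ _ _ _ gammahE).
  (* The vectors [sqrtA (phih i)] are orthogonal with squared norms [lambdah i], so the adjoint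
     composed with [sqrtA \o gammah] is diagonal. *)
  have -> : rank_sum ip m M (sqrtA \o phih) phih ((sqrtA \o gammah) v) =
      \sum_(m <= i < M.+1) (lambdah i * ip v (phih i)) *: phih i.
    rewrite gammahE; apply: eq_big_nat => i iJ; congr (_ *: _).
    rewrite (ip_suml ip) (bigD1_seq i) ?iota_uniq ?mem_index_iota //=.
    rewrite (ipZl ip) gal ?JN // uJ_on // eqxx mulr1 big_seq_cond big1.
      by rewrite addr0 mulrC.
    move=> j; rewrite mem_index_iota => /andP[jJ ji].
    by rewrite (ipZl ip) gal ?JN // uJ_on // (negPf ji) !mulr0.
  rewrite gammahE (@op_pow_eq _ _ _ _ _ phi_basis _ _
    (\sum_(m <= i < M.+1) (lambdah i * ip v (phih i)) *:
       op_pow ip lambda phi (- 2^-1) (phih i))) => [|k k1].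
    rewrite -sumrB; apply: eq_bigr => i _.
    by rewrite scalerBr scalerA [lambdah i * _]mulrC.
  rewrite !(ip_suml ip) mulr_sumr; apply: eq_big_nat => i iJ; rewrite !(ipZl ip).
  rewrite (ip_op_pow ip ip_norm _ _ phi_basis) //; first by ring.
  by apply: dom_pow_oppr => // j j1; apply: lambda_ndecr; rewrite j1.
pose r := residual_vector ip lambda phi lambdah phih.
pose a i j := ip (phih j) (phi i) ^+ 2.
have -> : (hs_norm e Res ^+ 2 = (\sum_(m <= i < M.+1) ip (r i) (r i))%:E)%E.
  exact: (hs_norm_rank_sum ip ip_norm e e_basis m M phih r Res uJ_on ResE).
have dist2 : (hs_norm e (fun v => gamma0 v - gammah v)%R ^+ 2 =
  (\sum_(m <= i < M.+1) 1 + \sum_(m <= i < M.+1) 1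
    - 2 * \sum_(m <= i < M.+1) \sum_(m <= j < M.+1) a i j)%:E)%E.
  rewrite (hs_norm_rank_sumB ip ip_norm e e_basis m M phi phi phih phih) //.
  congr (_ + _ - _ * _)%:E.
  - by apply: eq_big_nat => i iJ; rewrite phi_on // eqxx.
  - by apply: eq_big_nat => i iJ; rewrite uJ_on // eqxx.
  - apply: eq_bigr => i _; apply: eq_bigr => j _.
    by rewrite (ipC ip (phi i)) -expr2.
have -> : (hs_norm e (fun v => sqrtA (gamma0 v - gammah v)%R) ^+ 2 =
  (\sum_(m <= i < M.+1) lambda i + \sum_(m <= j < M.+1) lambdah j
    - 2 * \sum_(m <= i < M.+1) \sum_(m <= j < M.+1) lambda i * a i j)%:E)%E.
  rewrite (hs_norm_rank_sumB ip ip_norm e e_basis m M _ _ _ _ _ phi_on uJ_on diffE).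
  congr (_ + _ - _ * _)%:E.
  - apply: eq_big_nat => i iJ /=; rewrite sqrtA_phi // (ipZl ip) (ipZr ip) phi_on
    //.
    by rewrite eqxx mulr1 -expr2 powR_half_sqr // lambda_gt0 // J1.
  - by apply: eq_big_nat => i iJ /=; rewrite gal ?JN // uJ_on // eqxx mulr1.
  - apply: eq_big_nat => i iJ; apply: eq_big_nat => j jJ /=.
    rewrite sqrtA_phi // (ipZl ip) (ipC ip _ (sqrtA _)) sqrtA_u ?J1 //.
    have := powR_half_sqr _ (lambda_gt0 _ (J1 _ iJ)).
    by move: (lambda i `^ 2^-1) => p <-; rewrite (ipC ip (phi i)) /a; ring.
have MJ : (m <= M < M.+1)%N by rewrite m_leM /=.
split.
  rewrite dist2 -EFinM -EFinD lee_fin.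
  apply: cluster_error_le => //.
  - exact/ltW/lambda_gt0/J1.
  - by move=> i iJ; apply: lambda_ndecr; rewrite J1 //=; case/andP: iJ.
  - move=> i iJ; apply: mu_ndecr => //; rewrite J1 //=; by case/andP: iJ.
  (* Bessel is used both ways: [phi i] against the discrete family, then [phih j] against the exact
     one. *)
  - move=> i iJ; have <- : ip (phi i) (phi i) = 1 by rewrite phi_on // eqxx.
    under eq_bigr do rewrite /a (ipC ip); exact: (bessel ip ip_norm).
  - move=> j jJ; have <- : ip (phih j) (phih j) = 1 by rewrite uJ_on // eqxx.
    exact: (bessel ip ip_norm).
  - by move=> j /JN jN; exact:
    (leak_le_residual ip ip_norm _ _ phi_basis lambda_gt0 N lambdah).
move=> _ low below muM_lt low_le.
set c := cluster_const m M lambdah low.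
have c_above : (1 - lambdah M / low)^-1 <= c.
  by rewrite /c /cluster_const; case: ifP => // _; rewrite le_max lexx orbT.
have leak_le j : (m <= j < M.+1)%N ->
    lambdah j - \sum_(m <= i < M.+1) lambda i * a i j <= c ^+ 2 * ip (r j) (r j).
  move=> jJ; apply: (leak_le_gap_residual ip ip_norm _ _ phi_basis lambda_gt0 N)
    => //.
    exact: JN.
  (* Indices below [m] and above [M] call for the two terms of the maximum. *)
  move=> k k1; rewrite negb_and -ltnNge -leqNgt => /orP[km|Mk].
    have m1 : (1 < m)%N by exact: leq_ltn_trans km.
    have [lmu gap] := below m1.
    have lk : lambda k <= lambdah m.-1.
      by apply: le_trans lmu; apply: lambda_ndecr; rewrite k1 -ltnS prednK // ltnW.
    have mj : lambdah m <= lambdah j.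
      by apply: mu_ndecr; [case/andP: jJ => ->; rewrite m_ge1 | case/andP: (JN _ jJ)].
    rewrite distrC ger0_norm; last by rewrite subr_ge0 (le_trans lk) //
      (le_trans (ltW gap)).
    apply: le_trans (le_gap_below _ _ _ _ (lambda_gt0 _ k1) lk gap mj) _.
    rewrite ler_wpM2r ?subr_ge0 //; first by rewrite (le_trans lk) //
      (le_trans (ltW gap)).
    by rewrite /c /cluster_const m1 le_max lexx.
  have lk : low <= lambda k by apply: le_trans low_le _; exact: lambda_ndecr.
  have jM : lambdah j <= lambdah M.
    by apply: mu_ndecr => //; rewrite J1 //=; case/andP: jJ.
  rewrite ger0_norm; last by rewrite subr_ge0 (le_trans jM) //
    (le_trans (ltW muM_lt)).
  apply: le_trans (le_gap_above _ _ _ _ (mu_gt0 _ (JN _ jJ)) jM muM_lt lk) _.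
  by rewrite ler_wpM2r // subr_ge0 (le_trans jM) // (le_trans (ltW muM_lt)).
have minmax : \sum_(m <= i < M.+1) lambda i <= \sum_(m <= i < M.+1) lambdah i.
  apply: ler_sum_nat => i /JN iN.
  exact: (eigenvalue_le_galerkin ip ip_norm _ _ phi_basis lambda_gt0 N _ phih).
have leak_sum := ler_sum_nat leak_le.
have expe4 (x : \bar R) : (x ^+ 4 = (x ^+ 2) ^+ 2)%E by rewrite !expeS !expe0
  !mule1 !muleA.
rewrite expe4 dist2 -EFin_expe -!EFinM -EFinD lee_fin.
rewrite sumrB exchange_big /= -mulr_sumr in leak_sum.
have quartic : 0 <= lambda M / 2 * (\sum_(m <= i < M.+1) 1 + \sum_(m <= i < M.+1) 1
    - 2 * \sum_(m <= i < M.+1) \sum_(m <= j < M.+1) a i j) ^+ 2.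
  by rewrite mulr_ge0 ?sqr_ge0 // divr_ge0 // ltW // lambda_gt0 // J1.
(* With L, U, T as in [cluster_error_le], [minmax] gives L + U - 2 T <= 2 (U - T), which [leak_sum]
   bounds; [quartic] is added as a nonnegative term. *)
by nra.
Qed.
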